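(* Let $K$ be an algebraically closed field, $X=\{x_1,\dots,x_n\}$ a set of variables, $U\subset X$ a subset with $m$ elements (the parameters), and $H,T\subseteq K[X]$ ideals. Fix a monomial order on the monomials in the variables $X\setminus U$, and let $\{(S_i,B_i): 1\le i\le s\}$ be the minimal canonical comprehensive Gröbner system (MCCGS) of the ideal $I=H+T$ with respect to the parameters $U$ and this order. Then the image of $\mathbb V(H+T)\subseteq K^n$ under the coordinate projection $K^n\to K^m$ onto the $U$-coordinates is obtained by discarding, if it exists, the unique segment $S_i$ with $B_i=\{1\}$ and keeping the remaining ones; that is, the projection equals $\bigcup_{i:\,B_i\neq\{1\}} S_i$.
   Context: $\mathbb V(J)$ denotes the zero set over $K$ of an ideal $J$. Let $U$ be a set of $m$ parameters, ${\bf x}$ the remaining variables, and $I$ an ideal of $K[U][{\bf x}]$. For ${\bf u_0}\in K^m$, let $\sigma_{\bf u_0}:K[U][{\bf x}]\to K[{\bf x}]$ be the specialization homomorphism substituting ${\bf u_0}$ for $U$. A Gröbner system of $I$ with respect to a monomial order $\succ_{\bf x}$ is a finite set of pairs $(S_i,B_i)$, $1\le i\le s$, where $S_i\subset K^m$ is a constructible set (a segment), $B_i\subset K[U][{\bf x}]$ is a finite set of polynomials, $\bigcup_i S_i=K^m$, and for all ${\bf u_0}\in S_i$ the set $\sigma_{\bf u_0}(B_i)$ is a Gröbner basis of the ideal $\sigma_{\bf u_0}(I)$ with respect to $\succ_{\bf x}$. The minimal canonical comprehensive Gröbner system (MCCGS) of $I$ is a canonically determined Gröbner system with the following properties. The segments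 $S_i$ form a partition of $K^m$. The polynomials in $B_i$ have content 1 with respect to ${\bf x}$ over $K[U]$. For each ${\bf u_0}\in S_i$, $B_i$ specializes (up to division by leading coefficients) to the reduced Gröbner basis of $\sigma_{\bf u_0}(I)$, with the same set of leading power products (lpp) for every ${\bf u_0}\in S_i$, i.e. the leading coefficients of the polynomials of $B_i$ vanish at no point of $S_i$. If a segment with basis $\{1\}$ exists, it is unique. The number of segments is minimal among partitions with the stated specialization property. *)

(* Defs.v *)
From HB Require Import structures.
From mathcomp Require Import all_boot all_order all_algebra.
From mathcomp Require Import finmap.
From mathcomp Require Import boolp classical_sets.
From mathcomp Require Import mpoly.

Set Implicit Arguments.
Unset Strict Implicit.
Unset Printing Implicit Defensive.

Import GRing.Theory.
Local Open Scope ring_scope.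
Local Open Scope classical_set_scope.

(* MathComp's [idealr_closed] only describes proper ideals; the unit ideal is
   essential here. *)
Record is_ideal (R : comNzRingType) (J : set R) : Prop := IsIdeal {
  ideal0 : J 0;
  idealD : forall p q, J p -> J q -> J (p + q);
  idealM : forall a p, J p -> J (a * p) }.

Definition ideal_gen (R : comNzRingType) (E : set R) : set R :=
  smallest (@is_ideal R) E.

Definition ideal_sum (R : comNzRingType) (H T : set R) : set R :=
  [set h + t | h in H & t in T].

Definition zeros (K : comNzRingType) (n : nat) (E : set {mpoly K[n]}) :
    set {ffun 'I_n -> K} :=
  [set v | forall p, E p -> p.@[v] = 0].

(* A finite union of locally closed sets V(E) \ V(F) *)
Definition constructible (K : comNzRingType) (n : nat)
    (A : set {ffun 'I_n -> K}) : Prop :=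
  exists (r : nat) (E F : 'I_r -> set {mpoly K[n]}),
    A = \bigcup_i (zeros (E i) `\` zeros (F i)).

(* [mo a b] reads "a is smaller than or equal to b".  Well-foundedness follows
   from [mo_ge0] by Dickson's lemma. *)
Record monomial_order (k : nat) (mo : rel 'X_{1..k}) : Prop := MonomialOrder {
  mo_refl : reflexive mo;
  mo_anti : antisymmetric mo;
  mo_trans : transitive mo;
  mo_total : total mo;
  mo_ge0 : forall a, mo 0%MM a;
  mo_add : forall c a b, mo a b -> mo (c + a)%MM (c + b)%MM }.

Section LeadingTerm.
Variables (R : comNzRingType) (k : nat) (mo : rel 'X_{1..k}).

(* Leading power product, with the junk value 0 for the zero polynomial *)
Definition lpp (p : {mpoly R[k]}) : 'X_{1..k} :=
  \big[(fun a b => if mo a b then b else a)/0%MM]_(a <- msupp p) a.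

Definition lc (p : {mpoly R[k]}) : R := p@_(lpp p).

Definition lt (p : {mpoly R[k]}) : {mpoly R[k]} := lc p *: 'X_[lpp p].

End LeadingTerm.

Section GroebnerBasis.
Variables (K : fieldType) (k : nat) (mo : rel 'X_{1..k}).

Definition initial_ideal (E : set {mpoly K[k]}) : set {mpoly K[k]} :=
  ideal_gen (lt mo @` E).

Definition groebner_basis (J : set {mpoly K[k]}) (G : {fset {mpoly K[k]}}) :
    Prop :=
  [set` G] `<=` J /\ initial_ideal [set` G] = initial_ideal J.

Definition reduced_groebner_basis (J : set {mpoly K[k]})
    (G : {fset {mpoly K[k]}}) : Prop :=
  [/\ groebner_basis J G,
      forall g, g \in G -> lc mo g = 1
    & forall g a, g \in G -> a \in msupp g ->
        ~ initial_ideal [set h | h \in G /\ h <> g] 'X_[a] ].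

End GroebnerBasis.

(* {mpoly {mpoly K[m]}[k]} is K[U][x], with m parameters and k variables. *)
Section GroebnerSystem.
Variables (K : fieldType) (m k : nat) (mo : rel 'X_{1..k}).
Variable I : set {mpoly {mpoly K[m]}[k]}.

Definition specialize (u : {ffun 'I_m -> K}) (f : {mpoly {mpoly K[m]}[k]}) :
    {mpoly K[k]} :=
  map_mpoly (meval u) f.

Record groebner_system (s : nat) (S : 'I_s -> set {ffun 'I_m -> K})
    (B : 'I_s -> {fset {mpoly {mpoly K[m]}[k]}}) : Prop := GroebnerSystem {
  gs_constructible : forall i, constructible (S i);
  gs_cover : \bigcup_i S i = setT;
  gs_basis : forall i u, S i u ->
    groebner_basis mo (specialize u @` I)
      [fset specialize u f | f in B i]%fset }.

(* Groebner systems over a partition whose bases specialize, up to division by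
   the leading coefficients, to the reduced Groebner bases, with leading power
   products constant on each segment *)
Record reduced_groebner_system (s : nat) (S : 'I_s -> set {ffun 'I_m -> K})
    (B : 'I_s -> {fset {mpoly {mpoly K[m]}[k]}}) : Prop :=
    ReducedGroebnerSystem {
  rgs_system : groebner_system S B;
  rgs_nonempty : forall i, S i !=set0;
  rgs_disjoint : trivIset setT S;
  rgs_lc : forall i u f, S i u -> f \in B i -> (lc mo f).@[u] != 0;
  rgs_reduced : forall i u, S i u ->
    reduced_groebner_basis mo (specialize u @` I)
      [fset ((lc mo f).@[u])^-1 *: specialize u f | f in B i]%fset }.

(* The gcd in K[U] of the coefficients of f is 1 (up to units). *)
Definition content1 (f : {mpoly {mpoly K[m]}[k]}) : Prop :=
  forall d : {mpoly K[m]},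
    (forall a, exists q, f@_a = q * d) -> d \is a GRing.unit.

(* [content1] only determines a basis element up to a factor in K^*.  The one
   consequence of the unit normalization that matters is [mccgs_unit]: a
   constant basis element is 1 itself, so that the basis of a segment on which
   I specializes to the unit ideal is {1}, not {c}. *)
Record is_mccgs (s : nat) (S : 'I_s -> set {ffun 'I_m -> K})
    (B : 'I_s -> {fset {mpoly {mpoly K[m]}[k]}}) : Prop := IsMCCGS {
  mccgs_system : reduced_groebner_system S B;
  mccgs_content : forall i f, f \in B i -> content1 f;
  mccgs_unit : forall i (c : K), (c%:MP)%:MP \in B i -> c = 1;
  mccgs_unique1 : forall i j,
    B i = [fset 1]%fset -> B j = [fset 1]%fset -> i = j;
  mccgs_minimal : forall s' (S' : 'I_s' -> set {ffun 'I_m -> K})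
      (B' : 'I_s' -> {fset {mpoly {mpoly K[m]}[k]}}),
    reduced_groebner_system S' B' -> (s <= s')%N }.

End GroebnerSystem.

Section ParametricIdeal.
Variables (K : fieldType) (n : nat) (U : {set 'I_n}).

(* The canonical isomorphism K[U][x] -> K[X]; the parameters and the remaining
   variables are the elements of U and of its complement, in increasing
   order. *)
Definition flatten_mpoly (f : {mpoly {mpoly K[#|U|]}[#|~: U|]}) :
    {mpoly K[n]} :=
  mmap (mmap (@mpolyC n K) (fun j : 'I_#|U| => 'X_(enum_val j)))
       (fun j : 'I_#|~: U| => 'X_(enum_val j)) f.

(* An ideal of K[X], seen as an ideal of K[U][x] *)
Definition parametric (J : set {mpoly K[n]}) :
    set {mpoly {mpoly K[#|U|]}[#|~: U|]} :=
  flatten_mpoly @^-1` J.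

Definition proj_params (v : {ffun 'I_n -> K}) : {ffun 'I_#|U| -> K} :=
  [ffun j => v (enum_val j)].

End ParametricIdeal.

(* Main.v *)
Require Import Defs.
From HB Require Import structures.
From mathcomp Require Import all_boot all_order all_algebra.
From mathcomp Require Import finmap.
From mathcomp Require Import boolp classical_sets.
From mathcomp Require Import mpoly.

(* Evaluating an element of I at a point (u, w) amounts to evaluating its
   specialization at u in w, so u lies in the projection iff the specialized
   ideal has a zero, i.e., by the weak Nullstellensatz, iff it is proper.  The
   reduced Groebner basis of the unit ideal is {1}; as the leading coefficients
   of B_i do not vanish at u and the contents are 1, this happens iff
   B_i = {1}.

   The Nullstellensatz goes by induction on the number of variables: after a
   Nagata change of variables the ideal contains a polynomial f that is monic
   in one variable; the induction hypothesis gives a zero of the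
   elimination ideal, and a resultant with f shows that the ideal stays proper
   when specialized there. *)

Set Implicit Arguments.
Unset Strict Implicit.
Unset Printing Implicit Defensive.

Import GRing.Theory.
Local Open Scope ring_scope.
Local Open Scope classical_set_scope.

(** * Ring morphisms, resultants, and extending a zero by one variable *)

Lemma mpoly_rmorph_ext (A : nzRingType) (R : comNzRingType) (n : nat)
    (F G : {rmorphism {mpoly A[n]} -> R}) :
    (forall c, F c%:MP = G c%:MP) -> (forall i, F 'X_i = G 'X_i) -> F =1 G.
Proof.
move=> eqC eqX p; rewrite [p]mpolyE !rmorph_sum /=.
apply: eq_bigr => a _; rewrite -mul_mpolyC !rmorphM /= eqC mpolyXE_id.
rewrite !rmorph_prod; congr (_ * _).
by apply: eq_bigr => i _; rewrite !rmorphXn /= eqX.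
Qed.

(* [map_resultant] only covers morphisms out of a polynomial ring, so it is
   applied to p and q with coefficients seen as constant polynomials. *)
Lemma rmorph_resultant (A : comNzRingType) (B : nzRingType)
    (f : {rmorphism A -> B}) (p q : {poly A}) :
    f (lead_coef p) != 0 -> f (lead_coef q) != 0 ->
  f (resultant p q) = resultant (map_poly f p) (map_poly f q).
Proof.
pose h0 : {rmorphism {poly A} -> A} := horner_eval 0.
have h0C c : h0 c%:P = c by exact: hornerC.
have mapC (C : nzRingType) (g : {rmorphism A -> C}) (r : {poly A}) :
    map_poly (g \o h0) (map_poly polyC r) = map_poly g r.
  by rewrite -map_poly_comp; apply: eq_map_poly => c /=; rewrite h0C.
have h0_id r : map_poly h0 (map_poly polyC r) = r.
  by rewrite -map_poly_comp map_poly_id // => c _ /=; apply: h0C.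
have lcC (r : {poly A}) : lead_coef (map_poly polyC r) = (lead_coef r)%:P.
  by rewrite lead_coef_map_inj //; apply: polyC_inj.
move=> fp0 fq0; rewrite -[p in LHS]h0_id -[q in LHS]h0_id.
have nz x : f x != 0 -> x != 0 by apply: contra_neq => ->; rewrite rmorph0.
rewrite -map_resultant ?lcC ?h0C ?nz //.
by rewrite -[LHS]/((f \o h0) _) map_resultant ?mapC //= lcC h0C.
Qed.

(** The section [lift] makes the image of [A] under [ev] an ideal of [K[X]]. It is proper by the
    resultant argument, so an image of minimal degree generates it and has a root [b], as [K] is
    algebraically closed. *)
Lemma extend_zero (K : closedFieldType) (D : comNzRingType)
    (ev : {rmorphism D -> K}) (lift : {rmorphism K -> D})
    (liftK : cancel lift ev)
    (A : set {poly D}) (idA : is_ideal A) (f : {poly D}) (f_monic : f \is monic)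
    (Af : A f) (ev0 : forall d, A d%:P -> ev d = 0) :
  exists b, forall q, A q -> (map_poly ev q).[b] = 0.
Proof.
have A1 : ~ A 1 by move=> /(ev0 1)/eqP; rewrite rmorph1 oner_eq0.
have evf : ev (lead_coef f) != 0 by rewrite (monicP f_monic) rmorph1 oner_eq0.
have f_gt1 : (1 < size f)%N.
  rewrite ltnNge; apply/negP => /size1_polyC fC; apply: A1.
  have /monicP := f_monic; rewrite fC lead_coefC => f1.
  by move: Af; rewrite fC f1.
(* Adding 'X^N * f to g with N large makes g monic, so that its resultant with f
   commutes with ev. *)
have ev_neq1 g : A g -> map_poly ev g <> 1.
  move=> Ag g1; pose g' := 'X^(size g) * f + g.
  have Ag' : A g' by apply: (idealD idA) => //; apply: (idealM idA).
  have szXf : size ('X^(size g) * f) = (size g + size f)%N.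
    by rewrite size_monicM ?monicXn ?monic_neq0 // size_polyXn.
  have g_lt : (size g < size ('X^(size g) * f)%R)%N.
    by rewrite szXf -[ltnLHS]addn0 ltn_add2l ltnW.
  have evg' : ev (lead_coef g') != 0.
    by rewrite lead_coefDl // lead_coef_monicM ?monicXn.
  have g'_gt1 : (1 < size g')%N.
    by rewrite size_polyDl // szXf (leq_trans f_gt1) // leq_addl.
  (* The resultant is a combination of [f] and [g'], hence a constant of [A], which [ev] kills. *)
  have [[u v] /= _ res] := resultant_in_ideal f_gt1 g'_gt1.
  have : ev (resultant f g') = 0.
    apply: ev0; rewrite res.
    by apply: (idealD idA); apply: (idealM idA).
  move/eqP; rewrite rmorph_resultant // resultant_eq0 ltn_neqAle eq_sym.
  (* The images of [f] and [g'] are coprime: a common divisor divides [map_poly ev g], which is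
     [1]. *)
  suff /eqP -> : size (gcdp (map_poly ev f) (map_poly ev g')) == 1%N by [].
  rewrite -dvdp1 -g1.
  rewrite -(@dvdp_addr _ (map_poly ev ('X^(size g) * f))).
    by rewrite -rmorphD dvdp_gcdr.
  by rewrite rmorphM dvdp_mull ?dvdp_gcdl.
pose P n :=
  `[< exists g, [/\ A g, map_poly ev g != 0 & size (map_poly ev g) = n] >].
have exP : exists n, P n.
  exists (size (map_poly ev f)); apply/asboolP; exists f; split=> //.
  by apply: contraNneq evf => f0; rewrite -coef_map f0 coef0.
case: (ex_minnP exP) => n /asboolP[g [Ag g0 szg]] n_min.
have Alift u : A (map_poly lift u * g) by apply: (idealM idA).
have mapK u : map_poly ev (map_poly lift u) = u.
  by rewrite -map_poly_comp; apply: map_poly_id => x _ /=; rewrite liftK.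
(* If this image were constant, dividing by it would yield an element of [A] with image [1]. *)
have /closed_rootP[b /eqP gb] : size (map_poly ev g) != 1%N.
  apply/negP => /eqP/eqP/size_poly1P[c c0 gc].
  apply: (ev_neq1 _ (Alift (c^-1)%:P)).
  by rewrite rmorphM /= mapK gc -polyCM mulVf.
(* The remainder modulo the minimal image is itself the image of an element of [A], so it
   vanishes. *)
exists b => q Aq; pose w := map_poly ev q %/ map_poly ev g.
have Ar : A (q + map_poly lift (- w) * g) by exact: (idealD idA).
have rE : map_poly ev (q + map_poly lift (- w) * g) =
    map_poly ev q %% map_poly ev g.
  rewrite rmorphD rmorphM /= mapK [X in X + _](divp_eq _ (map_poly ev g)).
  by rewrite mulNr addrC addKr.
have [r0|r0] := eqVneq (map_poly ev q %% map_poly ev g) 0.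
  rewrite (divp_eq (map_poly ev q) (map_poly ev g)) r0 addr0.
  by rewrite hornerM gb mulr0.
have /n_min : P (size (map_poly ev q %% map_poly ev g)).
  by apply/asboolP; exists (q + map_poly lift (- w) * g); rewrite rE.
by rewrite -szg leqNgt ltn_modp g0.
Qed.

(** * Nagata's change of variables *)

(** Reduction modulo [N] yields the digit of index [0]; the quotient by [N] is the sum for the
    remaining digits. *)
Lemma digits_inj (N n : nat) (a b : 'I_n -> nat) :
    (forall i, a i < N)%N -> (forall i, b i < N)%N ->
    (\sum_(i < n) a i * N ^ i = \sum_(i < n) b i * N ^ i)%N -> a =1 b.
Proof.
elim: n a b => [|n IHn] a b aN bN; first by move=> _ [].
have shift c : (\sum_(i < n.+1) c i * N ^ i =
    (\sum_(i < n) c (lift ord0 i) * N ^ i) * N + c ord0)%N.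
  rewrite big_ord_recl expn0 muln1 addnC big_distrl; congr (_ + _)%N.
  by apply: eq_bigr => i _; rewrite lift0 expnSr mulnA.
have N_gt0 : (0 < N)%N by rewrite (leq_ltn_trans _ (aN ord0)).
rewrite !shift => eq_sum i.
have /(congr1 (modn^~ N)) := eq_sum; rewrite !modnMDl !modn_small // => eq0.
have /(congr1 (divn^~ N)) := eq_sum; rewrite !divnMDl // !divn_small // !addn0.
by move=> /IHn-eqS; case: (unliftP ord0 i) => [j|] ->; rewrite ?eqS.
Qed.

Section Nagata.
Variables (K : fieldType) (n N : nat).

(* When N exceeds all exponents, distinct monomials are sent to monic
   polynomials of distinct degrees, whose base N digits are the exponents. *)
Definition nagata_var (i : 'I_n.+1) : {poly {mpoly K[n]}} :=
  'X^(N ^ i) + (if unlift ord0 i is Some j then 'X_j else 0)%:P.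

Definition nagata : {mpoly K[n.+1]} -> {poly {mpoly K[n]}} :=
  mmap (polyC \o @mpolyC n K) nagata_var.

HB.instance Definition _ := GRing.RMorphism.on nagata.

Hypothesis N_gt0 : (0 < N)%N.

Lemma nagata_var_exp_monic i d : nagata_var i ^+ d \is monic.
Proof. by rewrite monic_exp // monicXnaddC // expn_gt0 N_gt0. Qed.

Lemma mmap1_nagata_monic a : mmap1 nagata_var a \is monic.
Proof. by apply: monic_prod => i _; apply: nagata_var_exp_monic. Qed.

Lemma size_mmap1_nagata a :
  size (mmap1 nagata_var a) = (\sum_(i < n.+1) a i * N ^ i).+1.
Proof.
pose Q (p : {poly {mpoly K[n]}}) d := (p \is monic) /\ size p = d.+1.
suff [] : Q (mmap1 nagata_var a) (\sum_(i < n.+1) a i * N ^ i)%N by [].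
apply: (big_ind2 Q); first by split; rewrite ?monic1 ?size_poly1.
  move=> p d q e [pm sp] [qm sq]; split; first by rewrite monicMr.
  by rewrite size_monicM ?monic_neq0 // sp sq addnS.
move=> i _; split; first exact: nagata_var_exp_monic.
rewrite -[LHS]prednK; last first.
  by rewrite lt0n size_poly_eq0 monic_neq0 ?nagata_var_exp_monic.
by rewrite size_exp size_XnaddC ?expn_gt0 ?N_gt0 // mulnC.
Qed.

End Nagata.

Arguments nagata_var {K n} N i.
Arguments nagata {K n} N p : rename.

(** The monomials of [p] have distinct weights [w], so the heaviest one alone produces the top
    degree, and [c] is the inverse of its coefficient. *)
Lemma nagata_monic (K : fieldType) (n : nat) (p : {mpoly K[n.+1]}) : p != 0 ->
  exists N c, nagata N (c%:MP * p) \is monic.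
Proof.
move=> p0; pose N := (msize p).+1.
pose w (a : 'X_{1..n.+1}) := (\sum_(i < n.+1) a i * N ^ i)%N.
have supp_lt a i : a \in msupp p -> (a i < N)%N.
  move=> /msize_mdeg_lt lt_a; rewrite ltnS (leq_trans _ (ltnW lt_a)) //.
  by rewrite mdegE (bigD1 i) //= leq_addr.
have w_inj a b : a \in msupp p -> b \in msupp p -> w a = w b -> a = b.
  move=> pa pb /digits_inj eq_ab; apply/mnmP; apply: eq_ab => i; exact: supp_lt.
have [a pa a_max] : exists2 a, a \in msupp p &
    forall b, b \in msupp p -> (w b <= w a)%N.
  have : exists d, has (fun a => w a == d) (msupp p).
    case E : (msupp p) => [|a s]; first by rewrite -msupp_eq0 E in p0.
    by exists (w a); rewrite /= eqxx.
  have bnd d : has (fun a => w a == d) (msupp p) ->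
      (d <= \max_(a <- msupp p) w a)%N.
    by move=> /hasP[a pa /eqP <-]; apply: leq_bigmax_seq.
  move=> exd; case: (ex_maxnP exd bnd) => d /hasP[a pa /eqP <-] dmax.
  by exists a => // b pb; apply: dmax; apply/hasP; exists b.
exists N, (p@_a)^-1.
have pa0 : p@_a != 0 by rewrite -mcoeff_msupp.
suff : nagata N p = ((p@_a)%:MP)%:P * mmap1 (nagata_var N) a +
   \sum_(b <- msupp p | b != a) ((p@_b)%:MP)%:P * mmap1 (nagata_var N) b.
  move=> pE; rewrite rmorphM /= [nagata _ _%:MP]mmapC /= pE mulrDr mulrA.
  rewrite -!rmorphM /= mulVf // rmorph1 mul1r.
  have lt_w : (size (\sum_(b <- msupp p | b != a)
      ((p@_b)%:MP)%:P * mmap1 (nagata_var N) b)%R <= w a)%N.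
    rewrite big_seq_cond; apply: leq_trans (size_sum _ _ _) _.
    apply/bigmax_leqP_seq => b _ /andP[pb ba].
    rewrite mul_polyC (leq_trans (size_scale_leq _ _)) // size_mmap1_nagata //.
    rewrite ltn_neqAle a_max // andbT.
    by apply: contra ba => /eqP/w_inj-> .
  rewrite monicE lead_coefDl; first by rewrite -monicE mmap1_nagata_monic.
  rewrite size_mmap1_nagata // ltnS mul_polyC.
  by rewrite (leq_trans (size_scale_leq _ _)).
by rewrite [LHS](bigD1_seq a) ?msupp_uniq.
Qed.

(** * The weak Nullstellensatz *)

(* Carrying the evaluation map phi along turns the change of variables of the
   induction step into a mere change of phi. *)
Lemma ideal_rmorph_zero (K : closedFieldType) (R : comNzRingType) (J : set R)
    (idJ : is_ideal J) (J1 : ~ J 1) (n : nat)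
    (phi : {rmorphism {mpoly K[n]} -> R}) :
  exists a : 'I_n -> K, forall p, J (phi p) -> p.@[a] = 0.
Proof.
elim: n phi => [|n IHn] phi.
  (* Without variables [p] is a constant; a nonzero one would put [1] in [J]. *)
  exists (fun=> 0) => p; rewrite (nvar0_mpolyC p) => Jp.
  rewrite mevalC; apply/eqP; apply: contra_notT J1 => c0.
  have := idealM idJ (phi (p@_0)^-1%:MP) Jp.
  by rewrite -rmorphM -mpolyCM mulVf ?rmorph1.
have [p0|/existsNP[p /not_implyP[Jp /eqP p_neq0]]] :=
  pselect (forall p, J (phi p) -> p = 0).
  by exists (fun=> 0) => p /p0 ->; rewrite meval0.
have [N [c mon]] := nagata_monic p_neq0.
(* The inverse substitution: each new variable stands for an old one minus a power of the variable
   of index [0], so that [ev \o nagata N] is [phi]. *)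
pose z (j : 'I_n) := phi 'X_(lift ord0 j) - phi 'X_ord0 ^+ (N ^ j.+1).
pose phi' : {rmorphism {mpoly K[n]} -> R} := mmap (phi \o @mpolyC n.+1 K) z.
have [a a0] := IHn phi'.
pose ev : {rmorphism {poly {mpoly K[n]}} -> R} :=
  horner_eval (phi 'X_ord0) \o map_poly phi'.
have evC d : ev d%:P = phi' d by rewrite /= map_polyC /horner_eval hornerC.
have ev_nagata : ev \o nagata N =1 phi.
  apply: mpoly_rmorph_ext => [d|i].
    rewrite -[LHS]/(ev (nagata N d%:MP)).
    by rewrite [nagata _ _]mmapC evC [LHS]mmapC.
  rewrite -[LHS]/(ev (nagata N 'X_i)) [nagata _ _]mmapX mmap1U.
  rewrite /nagata_var rmorphD evC /= map_polyXn /horner_eval hornerXn.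
  case: unliftP => [j|] ->; last by rewrite rmorph0 addr0 expn0 expr1.
  by rewrite [phi' _]mmapX mmap1U /z lift0 addrC subrK.
pose A := [set q | J (ev q)].
have idA : is_ideal A.
  split=> [|q r|q r]; rewrite /A /mkset ?rmorph0 ?rmorphD ?rmorphM.
  - exact: ideal0.
  - exact: idealD.
  - exact: idealM.
have Af : A (nagata N (c%:MP * p)).
  by rewrite /A /mkset [X in J X]ev_nagata rmorphM; apply: idealM.
(* A constant [d] lies in [A] iff [J (phi' d)], so [a] is a zero of the elimination ideal of [A]. *)
have [b b0] := extend_zero (@mevalC _ _ a) idA mon Af
  (fun d Ad => a0 d (eq_ind _ J Ad _ (evC d))).
pose pt : {rmorphism {poly {mpoly K[n]}} -> K} :=
  horner_eval b \o map_poly (meval a).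
(* Evaluating [nagata_var] carries the zero [(a, b)] back to the original coordinates. *)
exists (fun i => pt (nagata_var N i)) => q Jq.
have pt_nagata : pt \o nagata N =1 meval (fun i => pt (nagata_var N i)).
  apply: mpoly_rmorph_ext => [d|i].
    rewrite -[LHS]/(pt (nagata N d%:MP)).
    rewrite [nagata _ _]mmapC [RHS]mevalC /= map_polyC /horner_eval hornerC.
    exact: mevalC.
  by rewrite -[LHS]/(pt (nagata N 'X_i)) [nagata _ _]mmapX mmap1U [RHS]mevalXU.
by rewrite -pt_nagata; apply: b0; rewrite /A /mkset [X in J X]ev_nagata.
Qed.

Lemma nullstellensatz (K : closedFieldType) (n : nat) (J : set {mpoly K[n]}) :
  is_ideal J -> ~ J 1 -> zeros J !=set0.
Proof.
move=> idJ J1; have [a a0] := ideal_rmorph_zero idJ J1 idfun.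
exists [ffun i => a i] => p /a0 pa; rewrite -[RHS]pa.
by apply: meval_eq => i; rewrite ffunE.
Qed.

(** * Operations on ideals *)

Lemma ideal_gen_sub (R : comNzRingType) (E : set R) : E `<=` ideal_gen E.
Proof. by move=> x Ex M [_]; apply. Qed.

Lemma ideal_gen1 (R : comNzRingType) (E : set R) (x : R) :
  E 1 -> ideal_gen E x.
Proof.
by move=> E1 M [idM EM]; rewrite -[x]mulr1; apply: (idealM idM); apply: EM.
Qed.

Lemma ideal_sum_ideal (R : comNzRingType) (H T : set R) :
  is_ideal H -> is_ideal T -> is_ideal (ideal_sum H T).
Proof.
move=> idH idT; split.
- by exists 0; [exact: ideal0|exists 0; [exact: ideal0|rewrite addr0]].
- move=> _ _ [h Hh [t Tt <-]] [h' Hh' [t' Tt' <-]].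
  exists (h + h'); first exact: idealD.
  by exists (t + t'); [exact: idealD|rewrite addrACA].
- move=> a _ [h Hh [t Tt <-]]; exists (a * h); first exact: idealM.
  by exists (a * t); [exact: idealM|rewrite mulrDr].
Qed.

Lemma ideal_preimage (A B : comNzRingType) (f : {rmorphism A -> B})
    (J : set B) :
  is_ideal J -> is_ideal (f @^-1` J).
Proof.
move=> idJ; split=> [|p q|p q]; rewrite /preimage /mkset;
  rewrite ?rmorph0 ?rmorphD ?rmorphM.
- exact: ideal0.
- exact: idealD.
- exact: idealM.
Qed.

Lemma ideal_image (A B : comNzRingType) (f : {rmorphism A -> B}) (J : set A) :
  (forall b, exists a, f a = b) -> is_ideal J -> is_ideal (f @` J).
Proof.
move=> f_surj idJ; split.
- by exists 0; rewrite ?rmorph0 //; apply: ideal0.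
- move=> _ _ [p Jp <-] [q Jq <-]; exists (p + q); rewrite ?rmorphD //.
  exact: idealD.
- move=> b _ [p Jp <-]; have [a <-] := f_surj b.
  by exists (a * p); rewrite ?rmorphM //; apply: idealM.
Qed.

(** * Leading monomials and reduced Gröbner bases of the unit ideal *)

Section MonomialOrder.
Variables (k : nat) (mo : rel 'X_{1..k}).
Hypothesis moP : monomial_order mo.

Lemma lpp_max (R : comNzRingType) (p : {mpoly R[k]}) a :
  a \in msupp p -> mo a (lpp mo p).
Proof.
rewrite /lpp; elim: (msupp p) => [//|b s IHs]; rewrite inE big_cons.
set c := \big[_/_]_(_ <- s) _.
have bc := mo_total moP b c.
move=> /orP[/eqP ->|/IHs ac]; case: ifP => // bc0; first exact: mo_refl.
by move: bc; rewrite bc0 => /= cb; apply: (mo_trans moP) ac cb.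
Qed.

Lemma lpp_eq0 (R : comNzRingType) (p : {mpoly R[k]}) :
  lpp mo p = 0%MM -> p = (lc mo p)%:MP.
Proof.
move=> p0; rewrite /lc p0; apply/mpolyP => a; rewrite mcoeffC.
have [->|a0] := eqVneq a 0%MM; first by rewrite mulr1.
rewrite mulr0; apply/eqP; rewrite mcoeff_eq0; apply: contraNN a0 => /lpp_max.
by rewrite p0 => a_le0; apply/eqP/(mo_anti moP); rewrite a_le0 mo_ge0.
Qed.

Lemma lpp1 (R : comNzRingType) : lpp mo (1 : {mpoly R[k]}) = 0%MM.
Proof. by rewrite /lpp -mpolyC1 msupp1 big_cons big_nil if_same. Qed.

Lemma lt1 (R : comNzRingType) : lt mo (1 : {mpoly R[k]}) = 1.
Proof. by rewrite /lt /lc lpp1 mcoeff1 eqxx scale1r mpolyX0. Qed.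

(** If no leading monomial in [G] were [0], the initial ideal would lie in the ideal [M] of
    polynomials without constant term. So [G] contains a constant, equal to [1] by monicity, and
    reducedness excludes any other element, since [lt mo 1] generates everything. *)
Lemma reduced_groebner_basis_unit (K : fieldType) (J : set {mpoly K[k]})
    (G : {fset {mpoly K[k]}}) :
  J 1 -> reduced_groebner_basis mo J G -> G = [fset 1]%fset.
Proof.
move=> J1 [[GJ inG] lcG redG].
have in1 : initial_ideal mo [set` G] 1.
  by rewrite inG; apply: ideal_gen_sub; exists 1; rewrite ?lt1.
have [g0 Gg0 g00] : exists2 g, g \in G & lpp mo g = 0%MM.
  apply: contrapT => noG; pose M := [set p : {mpoly K[k]} | p@_0%MM = 0].
  have idM : is_ideal M.
    split=> [|p q|a p]; rewrite /M /mkset ?mcoeff0 //.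
    - by move=> p0 q0; rewrite mcoeffD p0 q0 addr0.
    - by move=> p0; rewrite rmorphM /= p0 mulr0.
  have : M 1.
    apply: in1; split=> // _ [g Gg <-]; rewrite /M /mkset mcoeffZ mcoeffX.
    case: eqP => [g0|_]; last by rewrite mulr0.
    by case: noG; exists g.
  by rewrite /M /mkset mcoeff1 eqxx => /eqP; rewrite oner_eq0.
have G1 : 1 \in G by rewrite -mpolyC1 -(lcG _ Gg0) -(lpp_eq0 g00).
apply/fsetP => g; rewrite in_fset1; apply/idP/eqP => [Gg|-> //].
apply: contrapT => /nesym g1; case: (redG g (lpp mo g) Gg).
  by rewrite mcoeff_msupp -/(lc mo g) lcG // oner_eq0.
apply: ideal_gen1; exists 1; last exact: lt1.
by split.
Qed.

End MonomialOrder.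

(** * Segments on which the ideal specializes to the unit ideal *)

Lemma specialize_surj (K : fieldType) (m k : nat) (u : {ffun 'I_m -> K}) p :
  exists f, specialize u f = p :> {mpoly K[k]}.
Proof.
exists (map_mpoly (@mpolyC m K) p); apply/mpolyP => a.
by rewrite !mcoeff_map_mpoly /= mevalC.
Qed.

Lemma specialize_ideal (K : fieldType) (m k : nat) (u : {ffun 'I_m -> K})
    (I : set {mpoly {mpoly K[m]}[k]}) :
  is_ideal I -> is_ideal (specialize u @` I).
Proof.
exact: (ideal_image (f := map_mpoly (meval u))) (specialize_surj u).
Qed.

Section Mccgs.
Variables (K : fieldType) (m k : nat) (mo : rel 'X_{1..k}).
Variables (I : set {mpoly {mpoly K[m]}[k]}) (s : nat).
Variables (S : 'I_s -> set {ffun 'I_m -> K}).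
Variables (B : 'I_s -> {fset {mpoly {mpoly K[m]}[k]}}).
Hypotheses (moP : monomial_order mo) (SB : is_mccgs mo I S B).

(** A basis element specializes at [u] to its leading coefficient, nonzero there, so its leading
    monomial is [0]; content 1 and the normalization then force it to be [1]. *)
Lemma mccgs_basis_unit i u :
  S i u -> (specialize u @` I) 1 -> B i = [fset 1]%fset.
Proof.
move=> Siu I1; have rgs := mccgs_system SB.
have /(reduced_groebner_basis_unit moP I1) /fsetP G1 :=
  rgs_reduced rgs Siu.
have Bi1 f : f \in B i -> f = 1.
  move=> Bf; have c0 := rgs_lc rgs Siu Bf.
  have : ((lc mo f).@[u])^-1 *: specialize u f = 1.
    by apply/eqP; rewrite -in_fset1 -G1; apply/imfsetP; exists f.
  move=> /(congr1 ( *:%R (lc mo f).@[u])).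
  rewrite scalerA mulfV // scale1r => spE.
  have /(congr1 (mcoeff (lpp mo f))) := spE.
  rewrite mcoeff_map_mpoly mcoeffZ mcoeff1 /= -/(lc mo f).
  have [f0 _|_ /eqP] := eqVneq (lpp mo f) 0%MM; last first.
    by rewrite mulr0 (negPf c0).
  have fC := lpp_eq0 moP f0.
  (* [f] has no other nonzero coefficient, so [lc mo f] divides them all and is a unit of [K[U]],
     hence a scalar. *)
  have /andP[/eqP lcC _] : lc mo f \is a GRing.unit.
    apply: (mccgs_content SB Bf) => a.
    by exists (a == 0%MM)%:R; rewrite {1}fC mcoeffC mulrC eq_sym.
  have [d fE] : exists d, f = (d%:MP)%:MP by exists (lc mo f)@_0; rewrite -lcC.
  by rewrite fE in Bf *; rewrite (mccgs_unit SB Bf) !mpolyC1.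
apply/fsetP => f; rewrite in_fset1; apply/idP/eqP => [/Bi1 //|->].
(* [B i] is nonempty, because the reduced basis contains [1]. *)
have := G1 1; rewrite in_fset1 eqxx => /imfsetP[g /= Bg _].
by rewrite -(Bi1 g Bg).
Qed.

Lemma mccgs_unit_basis i u :
  S i u -> B i = [fset 1]%fset -> (specialize u @` I) 1.
Proof.
move=> Siu B1; have rgs := mccgs_system SB.
have [GI _] := gs_basis (rgs_system rgs) Siu.
apply: GI; rewrite B1 /=; apply/imfsetP.
exists 1 => /=; first by rewrite in_fset1.
by rewrite /specialize rmorph1.
Qed.

End Mccgs.

(** * From [K[U][x]] to [K[X]], on polynomials and on points *)

Section Flatten.
Variables (K : fieldType) (n : nat) (U : {set 'I_n}).

Local Notation flatten := (@flatten_mpoly K n U).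

HB.instance Definition _ := GRing.RMorphism.copy flatten
  (mmap (mmap (@mpolyC n K) (fun j : 'I_#|U| => 'X_(enum_val j)))
     (fun j : 'I_#|~: U| => 'X_(enum_val j))).

Lemma flatten_mpolyX j : flatten 'X_j = 'X_(enum_val j).
Proof. by rewrite [LHS]mmapX mmap1U. Qed.

Lemma flatten_mpolyCX j : flatten ('X_j)%:MP = 'X_(enum_val j).
Proof. by rewrite [LHS]mmapC /= mmapX mmap1U. Qed.

Lemma flatten_mpolyCC c : flatten (c%:MP)%:MP = c%:MP.
Proof. by rewrite [LHS]mmapC /= mmapC. Qed.

(** A morphism [g] sends each variable to a chosen preimage; [flatten \o g] fixes constants and
    variables, hence every polynomial. *)
Lemma flatten_mpoly_surj p : exists f, flatten f = p.
Proof.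
have /choice[h hE] i : exists f, flatten f = 'X_i.
  have [iU|iU] := boolP (i \in U).
    exists ('X_(enum_rank_in iU i))%:MP.
    by rewrite flatten_mpolyCX enum_rankK_in.
  have iU' : i \in ~: U by rewrite inE.
  by exists 'X_(enum_rank_in iU' i); rewrite flatten_mpolyX enum_rankK_in.
pose g : {rmorphism {mpoly K[n]} -> {mpoly {mpoly K[#|U|]}[#|~: U|]}} :=
  mmap (@mpolyC #|~: U| _ \o @mpolyC #|U| K) h.
exists (g p); move: p.
apply: (mpoly_rmorph_ext (F := flatten \o g) (G := idfun)) => [c|i] /=.
  by rewrite /g mmapC flatten_mpolyCC.
by rewrite /g mmapX mmap1U hE.
Qed.

Lemma parametric_ideal (J : set {mpoly K[n]}) :
  is_ideal J -> is_ideal (parametric (U := U) J).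
Proof. exact: (ideal_preimage flatten). Qed.

(** Both sides are ring morphisms in [f], so they are compared on variables and coefficients, and
    for the latter on parameters and scalars. *)
Lemma meval_flatten (v : {ffun 'I_n -> K}) f :
  (flatten f).@[v] =
    (specialize (proj_params U v) f).@[fun j => v (enum_val j)].
Proof.
pose sp : {rmorphism {mpoly {mpoly K[#|U|]}[#|~: U|]} -> {mpoly K[#|~: U|]}} :=
  map_mpoly (meval (proj_params U v)).
move: f; apply: (mpoly_rmorph_ext (F := meval v \o flatten)
  (G := meval _ \o sp)) => [c|j] /=; last first.
  by rewrite flatten_mpolyX map_mpolyX !mevalXU.
rewrite map_mpolyC mevalC [flatten _]mmapC.
move: c; apply: (mpoly_rmorph_ext (F := meval v \o mmap _ _)
  (G := meval _)) => [c|j] /=.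
  by rewrite mmapC !mevalC.
by rewrite mmapX mmap1U !mevalXU ffunE.
Qed.

Lemma glue_points (u : {ffun 'I_#|U| -> K}) (w : {ffun 'I_#|~: U| -> K}) :
  exists2 v, proj_params U v = u & forall j, v (enum_val j) = w j.
Proof.
(* Each index lies in exactly one of [U] and its complement, so one of the two conditions on [x] is
   vacuous. *)
pose P i x := (forall j : 'I_#|U|, enum_val j = i -> x = u j) /\
  (forall j : 'I_#|~: U|, enum_val j = i -> x = w j).
have /choice[v vP] i : exists x, P i x.
  have [iU|iU] := boolP (i \in U).
    exists (u (enum_rank_in iU i)); split=> j ji.
      by congr (_ _); apply: enum_val_inj; rewrite enum_rankK_in.
    by have := enum_valP j; rewrite ji inE iU.
  have iU' : i \in ~: U by rewrite inE.
  exists (w (enum_rank_in iU' i)); split=> j ji.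
    by have := enum_valP j; rewrite ji (negPf iU).
  by congr (_ _); apply: enum_val_inj; rewrite enum_rankK_in.
exists (finfun v) => [|j]; last by rewrite ffunE (proj2 (vP _) j).
by apply/ffunP => j; rewrite !ffunE (proj1 (vP _) j).
Qed.

End Flatten.

(** * The projection as a union of segments *)

Theorem proposition2 (K : closedFieldType) (n : nat) (U : {set 'I_n})
    (H T : set {mpoly K[n]}) (idealH : is_ideal H) (idealT : is_ideal T)
    (mo : rel 'X_{1..#|~: U|}) (moP : monomial_order mo)
    (s : nat) (S : 'I_s -> set {ffun 'I_#|U| -> K})
    (B : 'I_s -> {fset {mpoly {mpoly K[#|U|]}[#|~: U|]}})
    (SB : is_mccgs mo (parametric (U := U) (ideal_sum H T)) S B) :
  proj_params U @` zeros (ideal_sum H T)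
    = \bigcup_(i in [set i | B i <> [fset 1]%fset]) S i.
Proof.
have [rgs _ _ _ _] := SB; have [gs _ _ _ _] := rgs.
apply/seteqP; split=> [_ [v v0 <-]|u [i Bi Siu]].
  have [i _ Siu] : (\bigcup_i S i) (proj_params U v) by rewrite (gs_cover gs).
  (* Some [f] in the ideal would specialize to [1], yet its flattening vanishes at [v]. *)
  exists i => // Bi1; have [f If f1] := mccgs_unit_basis SB Siu Bi1.
  by have /eqP := v0 _ If; rewrite meval_flatten f1 meval1 oner_eq0.
have idI := specialize_ideal u
  (parametric_ideal U (ideal_sum_ideal idealH idealT)).
(* The specialized ideal is proper because [B i] is not [{1}]. *)
have [w w0] := nullstellensatz idI
  (fun I1 => Bi (mccgs_basis_unit moP SB Siu I1)).
have [v vu vw] := glue_points u w.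
exists v => // p Hp; have [f fp] := flatten_mpoly_surj U p.
rewrite -fp meval_flatten vu (meval_eq _ vw); apply: w0; exists f => //.
by rewrite /parametric /preimage /mkset fp.
Qed.
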